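(* Let $n\geq 1$, let $k\ge2$ be even, and let $m=k/2$. Let $C_{\mathbb{S}}(n,k)=\langle\operatorname{Tr}\mathbf{x}^k\rangle_{\mathbb{S}}$ be the expectation on the spin factor $\mathbb{S}=\mathbb{S}_{1,n}$, and let $B_m$ be the barbell group. Then $$\frac{1}{|B_m|}\,C_{\mathbb{S}}(n,k)=\sum_{\Gamma\in G(m)}\frac{n^{N(\Gamma)}}{|\operatorname{Aut}\Gamma|},$$ where $G(m)$ is the set of equivalence classes of barbell graphs with $m$ barbells.
   Context: **Spin factor.** $\mathbb{S}_{1,n}$ is the real vector space $\mathbb{R}\times\mathbb{R}^n$, with elements $\mathbf{x}=(x_0,x)$, and product $\mathbf{x}\bullet\mathbf{y}=(x_0y_0+x\cdot y,\;x_0y+y_0x)$, where $\cdot$ is the Euclidean dot product. The trace is $\operatorname{Tr}(\mathbf{x})=x_0$. Powers: $\mathbf{x}^1=\mathbf{x}$, $\mathbf{x}^k=\mathbf{x}\bullet\mathbf{x}^{k-1}$ for $k>1$. For a polynomial function $h$ on $\mathbb{S}$, $\langle h\rangle_{\mathbb{S}}=\int_{\mathbb{S}}h(\mathbf{x})e^{-\operatorname{Tr}(\mathbf{x}^2)/2}d\mathbf{x}\Big/\int_{\mathbb{S}}e^{-\operatorname{Tr}(\mathbf{x}^2)/2}d\mathbf{x}$, with Lebesgue measure. For fixed even $k$, $C_{\mathbb{S}}(n,k)$ is a polynomial in $n$. **Barbell group.** $\Xi_k$ is the set $\{1,\dots,k\}$ with edges (barbells) joining $\{1,2\},\{3,4\},\dots,\{k-1,k\}$.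 The barbell group $B_m=\mathbb{Z}/2\mathbb{Z}\wr S_m$, of order $2^m m!$, acts on $\Xi_k$ by permuting the $m$ barbells and flipping them independently; it is the subgroup of $S_k$ preserving the set of barbells. **Barbell graphs.** A barbell graph $\Gamma$ with $m$ barbells consists of $\Xi_k$, an arbitrary coloring of its vertices black or green (the two ends of a barbell need not have the same color), and a partition of the vertices into 2-element subsets each of which is monochromatic. It is regarded as a (multi)graph on $\{1,\dots,k\}$ whose edges are the barbells and the pairs. Two barbell graphs are equivalent if some element of $B_m$ carries one to the other (with coloring and pairing). $N(\Gamma)$ is the number of connected components of $\Gamma$ containing at least one green vertex. $\operatorname{Aut}\Gamma\subset B_m$ is the subgroup of elements carrying $\Gamma$ (coloring and pairing) to itself. *)

(* Defs.v *)
From HB Require Import structures.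
From mathcomp Require Import all_boot all_order all_algebra all_fingroup.
From mathcomp Require Import all_classical all_reals all_analysis.

Set Implicit Arguments.
Unset Strict Implicit.
Unset Printing Implicit Defensive.

Import Order.TTheory GRing.Theory Num.Theory.
Import numFieldNormedType.Exports.

Local Open Scope classical_set_scope.
Local Open Scope ring_scope.

(* Row vectors carry the product sigma-algebra, as n.-tuple T does in the
   library; for T a realType it is the Borel sigma-algebra. *)
Definition measure_row_display : measure_display -> measure_display.
Proof. exact. Qed.

Section measurable_row.
Context {d} {T : measurableType d}.
Variable n : nat.

Let coors : 'I_n -> 'rV[T]_n -> T := fun i x => x ord0 i.

Let row_set0 : g_sigma_preimage coors set0.
Proof. exact: sigma_algebra0. Qed.

Let row_setC A : g_sigma_preimage coors A -> g_sigma_preimage coors (~` A).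
Proof. exact: sigma_algebraC. Qed.

Let row_bigcup (F : _^nat) : (forall i, g_sigma_preimage coors (F i)) ->
  g_sigma_preimage coors (\bigcup_i (F i)).
Proof. exact: sigma_algebra_bigcup. Qed.

HB.instance Definition _ := @isMeasurable.Build (measure_row_display d)
  'rV[T]_n (g_sigma_preimage coors) row_set0 row_setC row_bigcup.

Lemma measurable_row_coord (i : 'I_n) :
  measurable_fun [set: 'rV[T]_n] (fun x : 'rV[T]_n => x ord0 i).
Proof.
move=> _ Y mY; rewrite setTI; apply: sub_sigma_algebra => /=.
rewrite -bigcup_seq/=; exists i => /=; first by rewrite mem_index_enum.
by exists Y => //; rewrite setTI.
Qed.

Lemma measurable_fun_row d' (S : measurableType d') (f : S -> 'rV[T]_n) :
  (forall i, measurable_fun setT (fun x => f x ord0 i)) ->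
  measurable_fun setT f.
Proof.
move=> mf _ A mA; rewrite setTI.
have : image_set_system setT f measurable A; last first.
  by rewrite /image_set_system /= setTI.
move: A mA; apply: smallest_sub.
  exact/sigma_algebra_image/sigma_algebra_measurable.
move=> A; rewrite -bigcup_seq => -[i _] [B mB <-].
rewrite /image_set_system /= !setTI.
by have := mf i measurableT B mB; rewrite setTI.
Qed.

End measurable_row.

Section lebesgue_row.
Variable R : realType.

Definition row_cons n (p : R * 'rV[R]_n) : 'rV[R]_n.+1 :=
  row_mx p.1%:M p.2.

Definition row_uncons n (x : 'rV[R]_n.+1) : R * 'rV[R]_n :=
  (x ord0 ord0, \row_(i < n) x ord0 (lift ord0 i)).

Lemma row_cons0 n p : @row_cons n p ord0 ord0 = p.1.
Proof.
transitivity ((p.1%:M : 'M[R]_1) ord0 ord0); last by rewrite mxE eqxx.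
rewrite -(row_mxEl (p.1%:M : 'M[R]_1) p.2); congr (row_mx _ _ _ _).
exact: val_inj.
Qed.

Lemma row_consS n p i : @row_cons n p ord0 (lift ord0 i) = p.2 ord0 i.
Proof.
rewrite -(row_mxEr (p.1%:M : 'M[R]_1) p.2); congr (row_mx _ _ _ _).
exact: val_inj.
Qed.

Lemma row_consK n : cancel (@row_cons n) (@row_uncons n).
Proof.
move=> [a v]; rewrite /row_uncons row_cons0; congr (_, _).
by apply/rowP => i; rewrite mxE row_consS.
Qed.

Lemma measurable_row_cons n : measurable_fun [set: R * 'rV[R]_n] (@row_cons n).
Proof.
apply: measurable_fun_row => i; case: (unliftP ord0 i) => [j ->|->].
  under eq_fun do rewrite row_consS.
  apply: (@measurableT_comp _ _ _ _ _ _ (fun x : 'rV[R]_n => x ord0 j)).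
    exact: measurable_row_coord.
  exact: measurable_snd.
under eq_fun do rewrite row_cons0.
exact: measurable_fst.
Qed.

Lemma measurable_row_uncons n : measurable_fun setT (@row_uncons n).
Proof.
apply: measurable_fun_pair; first exact: measurable_row_coord.
apply: measurable_fun_row => i; under eq_fun do rewrite mxE.
exact: measurable_row_coord.
Qed.

Section cons_measure.
Variables (n : nat) (mu : {sigma_finite_measure set 'rV[R]_n -> \bar R}).

(* Product of the Lebesgue measure of R with mu, on R x R^n = R^(n+1). *)
Definition cons_measure : set 'rV[R]_n.+1 -> \bar R :=
  pushforward ((@lebesgue_measure R) \x mu)%E (@row_cons n).

Let cons_measure0 : cons_measure set0 = 0%E.
Proof. by rewrite /cons_measure /pushforward preimage_set0 measure0. Qed.

Let cons_measure_ge0 A : (0 <= cons_measure A)%E.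
Proof. by rewrite /cons_measure /pushforward measure_ge0. Qed.

Let cons_measure_additive : semi_sigma_additive cons_measure.
Proof.
move=> F mF tF mUF; rewrite /cons_measure /pushforward preimage_bigcup.
have mpre A : measurable A -> measurable (@row_cons n @^-1` A).
  by move=> mA; rewrite -[X in measurable X]setTI; exact: measurable_row_cons.
apply: measure_semi_sigma_additive => [k||]; first exact: mpre.
  apply/trivIsetP => /= i j _ _ ij; rewrite -preimage_setI.
  by move/trivIsetP : tF => /(_ _ _ _ _ ij) ->//; rewrite preimage_set0.
by rewrite -preimage_bigcup; exact: mpre.
Qed.

HB.instance Definition _ := isMeasure.Build _ _ _ cons_measure
  cons_measure0 cons_measure_ge0 cons_measure_additive.

Let cons_measure_sigma_finite : sigma_finite setT cons_measure.
Proof.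
have /sigma_finiteP[F [TF ndF Foo]] := sigma_finiteT (@lebesgue_measure R).
have /sigma_finiteP[G [TG ndG Goo]] := sigma_finiteT mu.
exists (fun k => @row_uncons n @^-1` (F k `*` G k)).
  rewrite -preimage_bigcup (_ : \bigcup_k _ = setT) ?preimage_setT//.
  rewrite predeqE => -[x y]; split=> // _.
  have [k _ Fkx] : (\bigcup_k F k) x by rewrite -TF.
  have [l _ Gly] : (\bigcup_k G k) y by rewrite -TG.
  exists (maxn k l) => //; split.
    by move: x Fkx; exact/subsetPset/ndF/leq_maxl.
  by move: y Gly; exact/subsetPset/ndG/leq_maxr.
move=> k; have [mF Fk] := Foo k; have [mG Gk] := Goo k; split.
  rewrite -[X in measurable X]setTI; apply: measurable_row_uncons => //.
  exact: measurableX.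
rewrite /cons_measure /pushforward -comp_preimage.
rewrite (_ : _ \o _ = id); last by apply/funext => x /=; rewrite row_consK.
by rewrite preimage_id product_measure1E// lte_mul_pinfty// ge0_fin_numE.
Qed.

HB.instance Definition _ := Measure_isSigmaFinite.Build _ _ _ cons_measure
  cons_measure_sigma_finite.

End cons_measure.

Fixpoint lebesgue_row n : {sigma_finite_measure set 'rV[R]_n -> \bar R} :=
  match n with
  | 0 => dirac (0 : 'rV[R]_0)
  | k.+1 => cons_measure (lebesgue_row k)
  end.

End lebesgue_row.

Section spin_factor.
Variables (R : realType) (n : nat).

Definition spin : Type := (R * 'rV[R]_n)%type.

Definition dot (x y : 'rV[R]_n) : R := \sum_(i < n) x ord0 i * y ord0 i.

Definition spin_mul (x y : spin) : spin :=
  (x.1 * y.1 + dot x.2 y.2, x.1 *: y.2 + y.1 *: x.2).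

Definition spin_one : spin := (1, 0).

(* x^1 = x and x^k = x * x^(k-1), with the unit as the value at k = 0. *)
Definition spin_pow (x : spin) (k : nat) : spin :=
  iterop k spin_mul x spin_one.

Definition spin_tr (x : spin) : R := x.1.

Definition spin_lebesgue :
    {measure set (measurableTypeR R * 'rV[R]_n) -> \bar R} :=
  ((@lebesgue_measure R) \x lebesgue_row R n)%E.

Definition spin_weight (x : spin) : R := expR (- (spin_tr (spin_pow x 2) / 2)).

Definition spin_expectation (h : spin -> R) : R :=
  (\int[spin_lebesgue]_x (h x * spin_weight x)) /
  (\int[spin_lebesgue]_x spin_weight x).

Definition spin_moment (k : nat) : R :=
  spin_expectation (fun x => spin_tr (spin_pow x k)).

End spin_factor.

Local Close Scope classical_set_scope.
Local Open Scope set_scope.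
Local Open Scope group_scope.

Section barbell.
Variable m : nat.

(* The 2m vertices, numbered from 0: the barbells are the pairs {2l, 2l+1}. *)
Definition Xi : finType := 'I_m.*2.

Definition barbells : {set {set Xi}} :=
  [set [set i : Xi | i./2 == l] | l : 'I_m].

Definition barbell_group : {set {perm Xi}} := 'N(barbells | 'P^* ).
Canonical barbell_group_group := [group of barbell_group].

Lemma barbell_groupE s : (s \in barbell_group) =
  ([set [set s i | i in B] | B : {set Xi} in barbells] == barbells).
Proof.
apply/idP/eqP => [sB|sB]; first exact: (astabs_setact sB).
apply/astabsP => B; rewrite -[in LHS]sB; apply/imsetP/idP => [[D DB]|].
  by move/(@imset_inj _ _ _ (@perm_inj _ s)) ->.
by exists B.
Qed.

(* A colouring (true = green, false = black) together with a set of sets of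
   vertices; barbell_graphs below selects the barbell graphs among these. *)
Definition colored_system : finType :=
  ({ffun Xi -> bool} * {set {set Xi}})%type.

Definition green (G : colored_system) (i : Xi) : bool := G.1 i.
Definition pairs (G : colored_system) : {set {set Xi}} := G.2.

Definition barbell_graphs : {set colored_system} :=
  [set G | finset.partition (pairs G) [set: Xi] &
    [forall e in pairs G, (#|e| == 2) &&
      [forall i in e, forall j in e, green G i == green G j]]].

Definition edges (G : colored_system) : {set {set Xi}} := barbells :|: pairs G.

Definition bg_adjacent (G : colored_system) : rel Xi :=
  fun i j => [exists e in edges G, (i \in e) && (j \in e)].

Definition components (G : colored_system) : {set {set Xi}} :=
  equivalence_partition (connect (bg_adjacent G)) [set: Xi].

Definition green_components (G : colored_system) : nat :=
  #|[set K in components G | [exists i in K, green G i]]|.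

(* s gives the vertex s i the colour of i, and turns the pair e into s @: e. *)
Definition carry (G : colored_system) (s : {perm Xi}) : colored_system :=
  ([ffun i => green G (s^-1 i)],
   [set [set s i | i in e] | e : {set Xi} in pairs G]).

Lemma carry1 : carry^~ 1 =1 id.
Proof.
move=> [c P]; rewrite /carry; congr (_, _).
  by apply/ffunP => i; rewrite ffunE invg1 perm1.
rewrite -[RHS]imset_id; apply: eq_imset => e.
by rewrite -[RHS]imset_id; apply: eq_imset => i; rewrite perm1.
Qed.

Lemma carryM G s t : carry G (s * t) = carry (carry G s) t.
Proof.
case: G => c P; rewrite /carry /=; congr (_, _).
  by apply/ffunP => i; rewrite !ffunE invMg permM /green /= ffunE.
rewrite /pairs /= -imset_comp; apply: eq_imset => e /=.
by rewrite -imset_comp; apply: eq_imset => i; rewrite /= permM.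
Qed.

Canonical carry_action := TotalAction carry1 carryM.

Definition barbell_graph_classes : {set {set colored_system}} :=
  orbit carry_action barbell_group @: barbell_graphs.

Definition barbell_aut (G : colored_system) : {set {perm Xi}} :=
  'C_(barbell_group)[G | carry_action].

End barbell.

(* Main.v *)
(* By orbit-stabiliser the right-hand side is 1/|B_m| times the sum of n^N over
   all labelled barbell graphs.  Fix the set S of green vertices and the pairing
   B of the black ones.  The barbells and B form a graph whose components are
   cycles avoiding S and paths with both ends in S, so they induce a pairing Q of
   S; then n^N counts the functions S -> {1..n} constant on the pairs of Q and on
   the green pairs.  Summing over the green pairs first, Wick's formula turns the
   sum over these functions f into the expectation of sum_f prod_v x_(f v) =
   |x|^|S| for a Gaussian vector x of R^n, which no longer depends on B; and the
   number of B is the Gaussian moment of x_0 of order 2m - |S|.  On the other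
   side, x_0 +- |x| are the eigenvalues of (x_0, x), so Tr x^k is the sum of
   x_0^(k - |S|) |x|^|S| over the subsets S of even cardinality. *)
Require Import Defs.
From HB Require Import structures.
From mathcomp Require Import all_boot all_order all_algebra all_fingroup.

Set Implicit Arguments.
Unset Strict Implicit.
Unset Printing Implicit Defensive.

Import GRing.Theory Num.Theory.

(** * Pairings and Wick's formula *)

Section Pairings.
Variable T : finType.
Implicit Types (V S e : {set T}) (P Q : {set {set T}}).

Definition pairing V P := partition P V && [forall e in P, #|e| == 2].

Definition monochromatic (L : eqType) P (f : T -> L) :=
  [forall e in P, forall i in e, forall j in e, f i == f j].

(** Functions from [S] to the values other than [o] are encoded as total functions equal to [o]
    exactly off [S], so that one finite type carries them for all [S]. *)
Definition has_support (L : eqType) (o : L) S (f : T -> L) :=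
  [forall v, (f v != o) == (v \in S)].

Lemma monochromaticP (L : eqType) P (f : T -> L) :
  reflect (forall e i j, e \in P -> i \in e -> j \in e -> f i = f j)
          (monochromatic P f).
Proof.
apply: (iffP forall_inP) => [fP e i j eP ie je|fP e eP].
  by apply/eqP; move: (fP e eP) => /forall_inP/(_ i ie)/forall_inP/(_ j je).
by apply/forall_inP => i ie; apply/forall_inP => j je; apply/eqP/(fP e).
Qed.

Lemma has_supportP (L : eqType) (o : L) S (f : T -> L) :
  reflect (forall v, (f v != o) = (v \in S)) (has_support o S f).
Proof. by apply: (iffP forallP) => fS v; [exact: (eqP (fS v)) | rewrite fS]. Qed.

(** Expanding the product over the blocks picks one value [l != o] per block, which is the same as a
    function supported on [S] and constant on each block. *)
Lemma sum_monochromatic (R : comPzSemiRingType) (L : finType) (o : L)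
    (y : L -> R) S Q : partition Q S ->
  (\sum_(f : {ffun T -> L} | has_support o S f && monochromatic Q f)
     \prod_(v in S) y (f v) =
   \prod_(e in Q) \sum_(l | l != o) y l ^+ #|e|)%R.
Proof.
move=> QS; have [/eqP cQ tQ Q0] := and3P QS.
rewrite (big_distr_big o) /=.
(* [F] spreads the value of a block over its vertices and [Fi] reads it off any vertex of the block;
   off [Q] the default [o] matches that of [big_distr_big]. *)
pose F (h : {ffun {set T} -> L}) : {ffun T -> L} :=
  [ffun v => if v \in S then h (pblock Q v) else o].
pose Fi (f : {ffun T -> L}) : {ffun {set T} -> L} :=
  [ffun e => if e \in Q then (if [pick v in e] is Some v then f v else o) else o].
rewrite (reindex_onto F Fi) /=; last first.
  move=> f /andP[/has_supportP fS /monochromaticP fQ].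
  apply/ffunP => v; rewrite !ffunE; case: ifP => vS; last first.
    by move: (fS v); rewrite vS => /negbFE/eqP.
  rewrite pblock_mem ?cQ //; case: pickP => [w wv|/(_ v)]; last first.
    by rewrite /= mem_pblock cQ vS.
  by apply: (fQ (pblock Q v)); rewrite ?pblock_mem ?mem_pblock ?cQ.
apply: eq_big => [h|h _].
  apply/andP/pfamilyP => /= [[/andP[/has_supportP fS _] /eqP Fih]|[hQ hQo]].
    split=> [|e eQ].
      apply/subsetP => e; rewrite inE -[in h e]Fih ffunE.
      by case: ifP; rewrite ?eqxx.
    have [v ve] : exists v, v \in e.
      by apply/set0Pn; apply: contraNneq Q0 => <-.
    have vS : v \in S by rewrite -cQ; apply/bigcupP; exists e.
    by move: (fS v); rewrite ffunE vS (def_pblock tQ eQ ve).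
  split; last first.
    apply/eqP/ffunP => e; rewrite !ffunE; case: ifP => eQ; last first.
      apply/esym/eqP; move: (subsetP hQ e); rewrite inE eQ.
      by case: eqP => // _ /(_ isT).
    case: pickP => [v ve|e0].
      have vS : v \in S by rewrite -cQ; apply/bigcupP; exists e.
      by rewrite ffunE vS (def_pblock tQ eQ ve).
    by case/negP: Q0; rewrite -(_ : e = set0) //; apply/setP => v; rewrite in_set0; apply: e0.
  apply/andP; split.
    apply/has_supportP => v; rewrite ffunE; case: ifP; rewrite ?eqxx // => vS.
    by apply: hQo; rewrite pblock_mem ?cQ.
  apply/monochromaticP => e i j eQ ie je.
  have eS w : w \in e -> w \in S by move=> we; rewrite -cQ; apply/bigcupP; exists e.
  by rewrite !ffunE !eS // !(def_pblock tQ eQ).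
rewrite (set_partition_big _ QS) /=; apply: eq_bigr => e eQ.
rewrite (eq_bigr (fun _ => y (h e))) => [|v ve]; first by rewrite prodr_const.
have vS : v \in S by rewrite -cQ; apply/bigcupP; exists e.
by rewrite ffunE vS (def_pblock tQ eQ ve).
Qed.

Lemma card_pairing V P : pairing V P -> #|V| = #|P| * 2.
Proof.
case/andP=> PV /forall_inP P2; rewrite (card_partition PV).
by rewrite (eq_bigr (fun=> 2)) ?sum_nat_const // => e /P2/eqP.
Qed.

Lemma pairing_partition V P : pairing V P -> partition P V.
Proof. by case/andP. Qed.

Lemma pairing_card2 V P e : pairing V P -> e \in P -> #|e| = 2.
Proof. by case/andP => _ /forall_inP P2 /P2/eqP. Qed.

Lemma pairing_set0 P : pairing set0 P = (P == set0).
Proof.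
rewrite /pairing partition_set0; apply: andb_idr => /eqP ->.
by apply/forall_inP => e; rewrite inE.
Qed.

Lemma pairingU1 V P e : pairing V P -> #|e| = 2 -> [disjoint e & V] ->
  pairing (e :|: V) (e |: P).
Proof.
move=> pP e2 eV; rewrite /pairing partitionU1 ?(pairing_partition pP) //=.
  apply/forall_inP => x /setU1P[->|/(pairing_card2 pP) ->//]; exact/eqP.
by rewrite -card_gt0 e2.
Qed.

Lemma pairingD1 V P e : pairing V P -> e \in P -> pairing (V :\: e) (P :\ e).
Proof.
move=> pP eP; rewrite /pairing partitionD1 ?(pairing_partition pP) //=.
by apply/forall_inP => x /setD1P[_ /(pairing_card2 pP) ->].
Qed.

(* The default value makes [partner P] the identity off the cover of P. *)
Definition partner P v := odflt v [pick u in pblock P v :\ v].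

Lemma partnerP V P v : pairing V P -> v \in V ->
  partner P v != v /\ pblock P v = [set v; partner P v].
Proof.
move=> pP vV; have cP := cover_partition (pairing_partition pP).
have vb : v \in pblock P v by rewrite mem_pblock cP.
have : #|pblock P v :\ v| = 1.
  by move: (cardsD1 v (pblock P v)); rewrite vb (pairing_card2 pP) ?pblock_mem ?cP // => -[].
move/eqP/cards1P=> [u Eu]; rewrite /partner Eu; case: pickP => [w /set1P ->|/(_ u)].
  split; last by rewrite -(setD1K vb) Eu.
  by move: (set11 u); rewrite -Eu => /setD1P[].
by rewrite set11.
Qed.

Lemma partner_in V P v : pairing V P -> v \in V -> partner P v \in V.
Proof.
move=> pP vV; have [_ Ev] := partnerP pP vV.
have cP := cover_partition (pairing_partition pP).
have bP : pblock P v \in P by rewrite pblock_mem ?cP.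
by apply: (subsetP (partitionS (pairing_partition pP) bP)); rewrite Ev set22.
Qed.

Lemma partner_out V P v : pairing V P -> v \notin V -> partner P v = v.
Proof.
move=> pP vV; rewrite /partner; case: pickP => // u /setD1P[_].
have -> : pblock P v = set0; last by rewrite inE.
apply/eqP; apply: contraNT vV => /set0Pn[w].
have cP := cover_partition (pairing_partition pP).
rewrite -cP -mem_pblock /pblock; case: pickP => [e /= /andP[]//|_].
by rewrite inE.
Qed.

Lemma partner_def V P e v u : pairing V P -> e \in P -> v \in e -> u \in e ->
  u != v -> partner P v = u.
Proof.
move=> pP eP ve ue uv; have PV := pairing_partition pP.
have vV : v \in V by apply: (subsetP (partitionS PV eP)).
have [_ Ev] := partnerP pP vV.
move: Ev; rewrite (def_pblock (partition_trivIset PV) eP ve) => Ee.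
by move: ue; rewrite Ee !inE (negPf uv) => /eqP.
Qed.

Lemma partnerK V P : pairing V P -> involutive (partner P).
Proof.
move=> pP v; have [vV|vV] := boolP (v \in V); last by rewrite !(partner_out pP).
have [uv Ev] := partnerP pP vV.
have cP := cover_partition (pairing_partition pP).
have bP : pblock P v \in P by rewrite pblock_mem ?cP.
by apply: (partner_def pP bP); rewrite ?Ev ?set21 ?set22 // eq_sym.
Qed.

Lemma monochromaticU (L : eqType) P Q (f : T -> L) :
  monochromatic (P :|: Q) f = monochromatic P f && monochromatic Q f.
Proof.
apply/monochromaticP/andP => [fPQ|[/monochromaticP fP /monochromaticP fQ]].
  by split; apply/monochromaticP => e i j eP; apply: fPQ; rewrite inE eP ?orbT.
by move=> e i j /setUP[]; [apply: fP|apply: fQ].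
Qed.

Lemma monochromatic_set2 (L : eqType) u v (f : T -> L) :
  monochromatic [set [set u; v]] f = (f u == f v).
Proof.
apply/monochromaticP/eqP => [fe|fuv].
  by apply: (fe [set u; v]); rewrite ?set11 ?set21 ?set22.
by move=> e i j /set1P -> /set2P[] -> /set2P[] ->.
Qed.

(** Deleting the pair {v, u} is a bijection whose inverse adds it back; [f u = f v] makes the added
    pair monochromatic. *)
Lemma card_pairing_step (L : finType) (f : T -> L) S v u :
    v \in S -> u \in S -> u != v -> f u = f v ->
  #|[set P | [&& pairing S P, monochromatic P f & partner P v == u]]| =
  #|[set P | pairing (S :\: [set v; u]) P && monochromatic P f]|.
Proof.
move=> vS uS uv fuv; set e := [set v; u].
have e2 : #|e| = 2 by rewrite cards2 eq_sym uv.
have dje : [disjoint e & S :\: e] by rewrite -setI_eq0 setDE setICA setICr setI0.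
have eS : e :|: (S :\: e) = S.
  by apply/setP => w; rewrite !inE; do 2?case: eqP => [->|_]; rewrite ?vS ?uS.
have eN Q : pairing (S :\: e) Q -> e \notin Q.
  move=> /pairing_partition QS; apply/negP => /(partitionS QS)/subsetP/(_ v).
  by rewrite !inE eqxx => /(_ isT).
pose D := [set P | pairing (S :\: e) P && monochromatic P f].
rewrite -[RHS]/#|D|; have injU : {in D &, injective (fun Q => e |: Q)}.
  move=> Q1 Q2; rewrite !inE => /andP[/eN e1 _] /andP[/eN e2' _] E12.
  by rewrite -(setU1K e1) E12 setU1K.
rewrite -(card_in_imset injU).
apply: eq_card => P; apply/idP/imsetP => [|[Q]].
  rewrite inE => /and3P[pP fP /eqP Pv].
  have cP := cover_partition (pairing_partition pP).
  have eP : e \in P.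
    by have [_] := partnerP pP vS; rewrite Pv -/e => <-; rewrite pblock_mem ?cP.
  exists (P :\ e); last by rewrite setD1K.
  rewrite inE pairingD1 //=.
  by move: fP; rewrite -{1}(setD1K eP) monochromaticU => /andP[].
rewrite !inE => /andP[pQ fQ] ->.
have pP : pairing S (e |: Q) by rewrite -eS pairingU1.
rewrite pP monochromaticU monochromatic_set2 fuv eqxx fQ /=.
by apply/eqP/(partner_def pP (setU11 _ _)); rewrite ?set21 ?set22.
Qed.


(** The a-th moment of a standard normal variable: 0 for odd a, (a-1)!! for even a. It is also the
    number of pairings of a set with a elements. *)
Fixpoint gaussian_moment (a : nat) : nat :=
  match a with
  | 0 => 1
  | 1 => 0
  | (b.+1 as c).+1 => c * gaussian_moment b
  end.

(* Wick's formula, by recursion on the partner of a chosen vertex. *)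
Lemma card_monochromatic_pairings (L : finType) (f : T -> L) S :
  #|[set P | pairing S P && monochromatic P f]| =
  \prod_(l : L) gaussian_moment #|[set v in S | f v == l]|.
Proof.
have [k] := ubnP #|S|; elim: k S => // k IH S.
have [->|[v vS]] := set_0Vmem S => Sk.
  rewrite (_ : [set P | _] = [set set0]).
    rewrite cards1 big1 // => l _; rewrite (_ : [set _ in _ | _] = set0) ?cards0 //.
    by apply/setP => w; rewrite !inE.
  apply/setP => P; rewrite !inE pairing_set0; apply: andb_idr => /eqP ->.
  by apply/monochromaticP => e i j; rewrite inE.
set A := [set P | _]; set D := [set u in S :\ v | f u == f v].
have AD P : P \in A -> partner P v \in D.
  rewrite inE => /andP[pP /monochromaticP fP]; have [uv Ev] := partnerP pP vS.
  rewrite !inE uv (partner_in pP vS) /=; apply/eqP; apply: (fP (pblock P v)).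
  - by rewrite pblock_mem ?(cover_partition (pairing_partition pP)).
  - by rewrite Ev set22.
  - by rewrite Ev set21.
rewrite -sum1_card (partition_big (fun P => partner P v) (mem D)) //=.
have DS : #|[set w in S | f w == f v]| = #|D|.+1.
  rewrite (cardsD1 v) !inE vS eqxx; congr _.+1; apply: eq_card => w.
  by rewrite !inE andbA.
(* Every partner [u] in [D] leaves the same count, so the total is [#|D|] times it; the recursion of
   [gaussian_moment] at [#|D|.+1] absorbs the factor, both sides being 0 if [D] is empty. *)
pose c l := gaussian_moment #|[set w in S | f w == l]|.
rewrite (eq_bigr (fun=> gaussian_moment #|D|.-1 * \prod_(l | l != f v) c l)).
  rewrite sum_nat_const mulnA [RHS](bigD1 (f v)) //= DS; congr (_ * _).
  by case: #|D|.
move=> u uD; have /setIdP[/setD1P[uv uS] /eqP fuv] := uD.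
rewrite sum1dep_card.
transitivity #|[set P | pairing (S :\: [set v; u]) P && monochromatic P f]|.
  rewrite -card_pairing_step //; apply: eq_card => P; rewrite !inE.
  by rewrite andbA.
rewrite IH; last first.
  rewrite -ltnS (leq_trans _ Sk) // ltnS; apply: proper_card.
  apply/properP; split; first exact: subsetDl.
  by exists v; rewrite // !inE eqxx.
(* Removing [v] and [u] lowers only the count of the value [f v], by two. *)
rewrite (bigD1 (f v)) //=; congr (_ * _).
  congr gaussian_moment; rewrite (cardsD1 u D) uD /=; apply: eq_card => w.
  by rewrite !inE; case: (w == u); case: (w == v).
apply: eq_bigr => l lv; congr gaussian_moment; apply: eq_card => w.
rewrite !inE; case: eqP => [->|_] /=; first by rewrite eq_sym (negPf lv) andbF.
by case: eqP => [->|_] //=; rewrite fuv eq_sym (negPf lv) andbF.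
Qed.

End Pairings.

(* On the cycle of x under f = beta \o b, the involution b acts as i |-> -i.
   As beta has no fixed point the cycle has even length, so b fixes exactly
   x and the point opposite to it. *)
Lemma card_fixed_connect (T : finType) (beta b : T -> T) (e : rel T) (x : T) :
    involutive beta -> involutive b -> (forall y, beta y != y) ->
    (forall y, e y (beta y)) -> (forall y, e y (b y)) ->
    (forall y z, e y z -> z \in [:: y; beta y; b y]) -> b x = x ->
  #|[set y | connect e x y && (b y == y)]| = 2.
Proof.
move=> betaK bK beta_free e_beta e_b eE bx; pose f y := beta (b y).
have injf : injective f by apply: inj_comp; apply: inv_inj.
have iter_inj i : injective (iter i f) by elim: i => // i IH; apply: inj_comp.
(* That is, [b] sends f^i x to f^(-i) x; it follows from f o b o f = b and b x = x. *)
have iter_b i : iter i f (b (iter i f x)) = x.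
  by elim: i => //= i IH; rewrite -iterS iterSr /f bK betaK.
set L := fingraph.order f x; have L0 : 0 < L by apply: fingraph.order_gt0.
have fL : iter L f x = x by apply: iter_order.
have iter_lt i : i < L -> iter i f x = x -> i = 0.
  by move=> iL fi; rewrite -(findex_iter iL) fi findex0.
(* The component of x is its f-orbit: a step of f is a b-edge followed by a beta-edge, and the orbit
   is closed under b, hence under beta = f o b. *)
have orbitE y : connect e x y = fconnect f x y.
  apply/idP/idP => [/connectP[p ep ->]|]; last first.
    apply: connect_sub y => y _ /eqP <-.
    exact: connect_trans (connect1 (e_b _)) (connect1 (e_beta _)).
  have orb_b w : fconnect f x w -> fconnect f x (b w).
    move=> xw; rewrite fconnect_sym // -(iter_findex xw).
    by rewrite -[X in fconnect _ _ X](iter_b (findex f x w)) fconnect_iter.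
  have : fconnect f x x by [].
  elim: p {-2 4}x ep => //= z p IH w /andP[ewz ep] xw; apply: IH => //.
  move: (eE _ _ ewz); rewrite !inE => /or3P[] /eqP ->; rewrite ?orb_b //.
  rewrite -[w]bK; apply: connect_trans (orb_b _ xw) _.
  by apply: connect1 => /=; rewrite /f.
(* If L = 2i+1, then b exchanges f^i x and f^(i+1) x, so that beta fixes f^(i+1) x. *)
have evenL : ~~ odd L.
  apply/negP => oL; set i := L./2.
  have Li : L = (i.+1 + i) by rewrite addSn addnn -(odd_double_half L) oL.
  have by_ : b (iter i.+1 f x) = iter i f x.
    apply: (iter_inj i.+1); rewrite iter_b.
    by rewrite -iterD -Li fL.
  have := beta_free (iter i.+1 f x).
  by rewrite -{1}(bK (iter i.+1 f x)) by_ -[beta _]/(f (iter i f x)) -iterS eqxx.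
set h := L./2; have Lh : L = h + h by rewrite addnn -[LHS](odd_double_half L) (negPf evenL).
have h0 : 0 < h by move: L0; rewrite Lh; case: (h).
pose y := iter h f x.
have byy : b y = y.
  by apply: (iter_inj h); rewrite iter_b /y -iterD -Lh fL.
have yx : y != x.
  have hL : h < L by rewrite Lh -addn1 leq_add2l.
  by apply/eqP => /(iter_lt _ hL) hz; move: h0; rewrite hz.
rewrite -[RHS](_ : #|[set x; y]| = 2); last by rewrite cards2 eq_sym yx.
apply: eq_card => z; rewrite !inE orbitE; apply/andP/orP => [[xz /eqP bz]|]; last first.
  by case=> /eqP ->; split; rewrite ?bx ?byy // fconnect_iter.
have iL := findex_max xz; move: bz; rewrite -(iter_findex xz).
set i := findex f x z in iL *; rewrite -/L in iL; move=> bz.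
(* A fixed point f^i x of b gives f^(2i) x = x with i < L, so 2i is 0 or L. *)
have f2i : iter (i + i) f x = x by rewrite iterD -bz iter_b.
have [iiL|Lii] := ltnP (i + i) L.
  by left; move/iter_lt: f2i => /(_ iiL); case: (i).
right; apply/eqP; congr iter.
have : i + i - L = 0.
  apply: iter_lt; first by rewrite ltn_subLR // (ltn_trans (_ : _ < L + i)) ?ltn_add2r ?ltn_add2l.
  by rewrite -{2}f2i -{2}(subnK Lii) iterD fL.
move/eqP; rewrite subn_eq0 => iiL; have : i + i == h + h by rewrite -Lh eqn_leq iiL.
by rewrite !addnn => /eqP/double_inj.
Qed.

(** * Components of a union of two pairings *)

Section Connectivity.
Variable T : finType.
Implicit Types (S e : {set T}) (E P B D : {set {set T}}).

(** For [E := edges G] this is convertible with [bg_adjacent G], so the results below apply to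
    barbell graphs directly. *)
Definition adjacent E : rel T :=
  fun i j => [exists e in E, (i \in e) && (j \in e)].

Lemma adjacentP E i j :
  reflect (exists e, [/\ e \in E, i \in e & j \in e]) (adjacent E i j).
Proof.
apply: (iffP exists_inP) => [[e eE /andP[ie je]]|[e [eE ie je]]]; exists e => //.
by rewrite ie.
Qed.

(** The nonempty intersections with [S] of the connected components of the graph [E]. When [E]
    consists of barbells and black pairs, they are the end pairs of the paths. *)
Definition traces E S := equivalence_partition (connect (adjacent E)) S.

Lemma connect_adjacent_sym E : connect_sym (adjacent E).
Proof.
apply: sym_connect_sym => i j; apply: eq_existsb => e.
by rewrite [X in _ && X]andbC.
Qed.

Lemma connect_adjacent_equiv E S :
  {in S & &, equivalence_rel (connect (adjacent E))}.
Proof.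
move=> x y z _ _ _; split=> [|xy]; first exact: connect0.
exact: (same_connect (connect_adjacent_sym E)).
Qed.

Lemma traces_partition E S : partition (traces E S) S.
Proof. exact/equivalence_partitionP/connect_adjacent_equiv. Qed.

Lemma monochromatic_tracesP (L : eqType) E S (f : T -> L) :
  reflect {in S &, forall v w, connect (adjacent E) v w -> f v = f w}
          (monochromatic (traces E S) f).
Proof.
apply: (iffP (monochromaticP _ _)) => [fE v w vS wS vw|fE e i j].
  apply: (fE (pblock (traces E S) v)).
  - by rewrite pblock_mem ?(cover_partition (traces_partition E S)).
  - by rewrite mem_pblock (cover_partition (traces_partition E S)).
  - by rewrite pblock_equivalence_partition //; apply: connect_adjacent_equiv.
case/imsetP=> v vS -> /[!inE] /andP[iS vi] /andP[jS vj]; apply: fE => //.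
by apply: connect_trans vj; rewrite connect_adjacent_sym.
Qed.

Lemma adjacent_partner V P v w : pairing V P -> adjacent P v w ->
  w \in [:: v; partner P v].
Proof.
move=> pP /adjacentP[e [eP ve we]]; rewrite !inE; case: eqVneq => //= wv.
by rewrite (partner_def pP eP ve we wv).
Qed.

Lemma partner_adjacent V P v : pairing V P -> v \in V ->
  adjacent P v (partner P v).
Proof.
move=> pP vV; have [_ Ev] := partnerP pP vV; apply/adjacentP.
exists (pblock P v); rewrite {2 3}Ev set21 set22.
by rewrite pblock_mem ?(cover_partition (pairing_partition pP)).
Qed.

Lemma adjacentU E P i j : adjacent (E :|: P) i j = adjacent E i j || adjacent P i j.
Proof.
apply/adjacentP/orP => [[e [/setUP[eE|eE] ie je]]|].
- by left; apply/adjacentP; exists e.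
- by right; apply/adjacentP; exists e.
by case=> /adjacentP[e [eE ie je]]; exists e; rewrite inE eE ?orbT.
Qed.

(** The partner maps of [D] and [B] are involutions generating the connectivity; the first has no
    fixed point and the second fixes exactly [S], so a component that meets [S] meets it in two
    points. *)
Lemma traces_pairing D B S : pairing setT D -> pairing (~: S) B ->
  pairing S (traces (D :|: B) S).
Proof.
move=> pD pB; rewrite /pairing traces_partition; apply/forall_inP => e.
case/imsetP => x xS ->.
have fixB y : (partner B y == y) = (y \in S).
  have [yS|yS] := boolP (y \in S).
    by rewrite (partner_out pB) ?eqxx // inE yS.
  by apply/negbTE; have [] := partnerP pB (_ : y \in ~: S); rewrite ?inE.
(* Loops are added because [partner B y] is [y] itself for [y] in [S]; they do not change
   connectivity. *)
pose r := [rel y z | (y == z) || adjacent (D :|: B) y z].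
rewrite (_ : #|_| = #|[set y | connect r x y && (partner B y == y)]|).
  apply/eqP/(@card_fixed_connect _ (partner D)).
  - exact: partnerK pD.
  - exact: partnerK pB.
  - by move=> y; have [] := partnerP pD (in_setT y).
  - by move=> y; rewrite /= adjacentU (partner_adjacent pD) ?inE // orbT.
  - move=> y; rewrite /= adjacentU; have [yS|yS] := boolP (y \in S).
      by rewrite (partner_out pB) ?inE ?yS // eqxx.
    by rewrite (partner_adjacent pB) ?inE ?yS // !orbT.
  - move=> y z /=; rewrite adjacentU !inE => /or3P[/eqP->|Dyz|Byz].
    + by rewrite eqxx.
    + by move: (adjacent_partner pD Dyz); rewrite !inE => /orP[]->; rewrite ?orbT.
    + by move: (adjacent_partner pB Byz); rewrite !inE => /orP[]->; rewrite ?orbT.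
  - by apply/eqP; rewrite fixB.
apply: eq_card => y; rewrite !inE fixB andbC; congr (_ && _).
apply/idP/idP; apply: connect_sub => {}y z /=; first by move=> yz; rewrite connect1 //= yz orbT.
by case/orP=> [/eqP->|/connect1].
Qed.

(* Adding pairs of S to E only merges traces on which f already agrees. *)
Lemma monochromatic_tracesU (L : eqType) E G S (f : T -> L) : partition G S ->
  monochromatic (traces (E :|: G) S) f =
  monochromatic (traces E S) f && monochromatic G f.
Proof.
move=> GS; apply/monochromatic_tracesP/andP => [fEG|[/monochromatic_tracesP fE]].
  split.
    apply/monochromatic_tracesP => v w vS wS vw; apply: fEG => //.
    by apply: (connect_sub _ vw) => y z yz; rewrite connect1 // adjacentU yz.
  apply/monochromaticP => e i j eG ie je.
  have eS := subsetP (partitionS GS eG); apply: fEG; rewrite ?eS // connect1 //.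
  by rewrite adjacentU; apply/orP; right; apply/adjacentP; exists e.
move=> /monochromaticP fG v w vS wS /connectP[p vp Ew].
(* Invariant along the path: the current vertex is linked by [E] alone to some [u] in [S] with
   [f v = f u]. After an edge of [G], its far end, which lies in [S], becomes the new [u]. *)
pose reached y := exists2 u, u \in S & connect (adjacent E) u y /\ f v = f u.
have reach_last y : path (adjacent (E :|: G)) y p -> reached y -> reached (last y p).
  elim: p y {vp Ew} => [|z p IH] y //= /andP[yz zp] [u uS [uy fu]].
  apply: (IH z) => //; move: yz; rewrite adjacentU.
  case/orP => [Eyz|/adjacentP[e [eG ye ze]]].
    by exists u => //; split=> //; apply: connect_trans uy (connect1 Eyz).
  have eS := subsetP (partitionS GS eG).
  exists z; rewrite ?eS //; split; first exact: connect0.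
  by rewrite fu (fE u y uS (eS _ ye) uy) (fG e y z).
have [|u uS [uw ->]] := reach_last v vp; first by exists v.
by apply: fE; rewrite // Ew.
Qed.

End Connectivity.

(** * Double counting of pairings and functions, with the black pairs fixed *)

Section BarbellSum.
Variable T : finType.
Implicit Types (S V e : {set T}) (P Q D B G : {set {set T}}).

Lemma pairingU V1 V2 P1 P2 : pairing V1 P1 -> pairing V2 P2 ->
  [disjoint V1 & V2] -> pairing (V1 :|: V2) (P1 :|: P2).
Proof.
move=> /andP[/and3P[/eqP c1 t1 n1] /forall_inP d1].
move=> /andP[/and3P[/eqP c2 t2 n2] /forall_inP d2] dV.
rewrite /pairing /partition trivIsetU ?c1 ?c2 // !inE negb_or n1 n2 !andbT /=.
rewrite {1}/cover bigcup_setU -!/(cover _) c1 c2 eqxx /=.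
by apply/forall_inP => e /setUP[/d1|/d2].
Qed.

Lemma pairing_restrict V S P : pairing V P ->
  {in P, forall e, (e \subset S) || (e \subset ~: S)} ->
  pairing (V :&: S) (P ::&: S).
Proof.
move=> pP PS; have PV := pairing_partition pP.
apply/andP; split; last first.
  by apply/forall_inP => e /setIdP[/(pairing_card2 pP) ->].
apply/and3P; split.
- rewrite eqEsubset; apply/andP; split.
    by rewrite -(cover_partition PV); apply: cover_setI.
  apply/subsetP => v /setIP[]; rewrite -(cover_partition PV) => /bigcupP[e eP ve] vS.
  apply/bigcupP; exists e => //; rewrite !inE eP /=.
  case/orP: (PS e eP) => // /subsetP/(_ v ve).
  by rewrite inE vS.
- by apply: trivIsetI; apply: partition_trivIset PV.
- by rewrite inE (partition0 PV).
Qed.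

Definition black_pairs S P := P ::&: ~: S.

Section Count.
Variables (L : finType) (o : L) (D : {set {set T}}) (S : {set T}).
Hypothesis pD : pairing setT D.

Let c v := v \in S.

Lemma monochromatic_split P : pairing setT P ->
  monochromatic P c -> {in P, forall e, (e \subset S) || (e \subset ~: S)}.
Proof.
move=> pP /monochromaticP cP e eP.
have [->|[v ve]] := set_0Vmem e; first by rewrite sub0set.
have [vS|vS] := boolP (v \in S); apply/orP; [left|right]; apply/subsetP => w we.
  by rewrite -/(c w) (cP e w v).
by rewrite inE -/(c w) (cP e w v).
Qed.

(** A pairing with black pairs [B] is [B :|: G] for a unique pairing [G] of [S], and by
    [monochromatic_tracesU] the condition on [f] splits into one on [B] and one on [G]. *)
Lemma card_pairs_over_black (B : {set {set T}}) (f : T -> L) :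
    pairing (~: S) B -> has_support o S f ->
  #|[set P | [&& pairing setT P, monochromatic P c,
       monochromatic (traces (D :|: P) S) f & black_pairs S P == B]]| =
  monochromatic (traces (D :|: B) S) f *
    #|[set G | pairing S G && monochromatic G f]|.
Proof.
move=> pB fS; set X := [set P | _]; set Y := [set G | _].
have BS e : e \in B -> e \subset ~: S by apply: partitionS (pairing_partition pB).
have traceE G : pairing S G -> monochromatic (traces (D :|: (B :|: G)) S) f =
    monochromatic (traces (D :|: B) S) f && monochromatic G f.
  by move=> pG; rewrite setUA monochromatic_tracesU // pairing_partition.
have sub_neq0 G e : pairing S G -> e \in G -> e \subset S /\ ~~ (e \subset ~: S).
  move=> pG eG; have PG := pairing_partition pG; have eS := partitionS PG eG.
  split=> //; have /set0Pn[v ve] := partition_neq0 PG eG.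
  by apply/subsetPn; exists v; rewrite // !inE negbK (subsetP eS).
have splitP P : P \in X -> [/\ P = B :|: (P ::&: S), pairing S (P ::&: S)
    & monochromatic (traces (D :|: B) S) f /\ P ::&: S \in Y].
  rewrite inE => /and4P[pP cP fP /eqP PB].
  have PS := monochromatic_split pP cP.
  have pG : pairing S (P ::&: S) by rewrite -{1}[S]setTI; apply: pairing_restrict.
  have EP : P = B :|: (P ::&: S).
    apply/setP => e; rewrite -PB !inE; case eP: (e \in P) => //=.
    by rewrite orbC PS.
  split=> //; rewrite inE pG; move: fP; rewrite {1}EP traceE //.
  by case/andP.
case fB: (monochromatic _ f); rewrite ?(mul0n, mul1n); last first.
  by apply/eqP; rewrite cards_eq0 -subset0; apply/subsetP => P /splitP[_ _ []]; rewrite fB.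
(* [G] is recovered as the set of pairs of [B :|: G] that lie inside [S]. *)
have injU : {in Y &, injective (fun G => B :|: G)}.
  move=> G1 G2; rewrite !inE => /andP[p1 _] /andP[p2 _] E12.
  have EG G : pairing S G -> G = (B :|: G) ::&: S.
    move=> pG; apply/setP => e; rewrite !inE.
    case eG: (e \in G); first by rewrite orbT; have [] := sub_neq0 _ _ pG eG.
    rewrite orbF; apply/esym/negbTE; apply/negP => /andP[eB eS].
    have := partition_neq0 (pairing_partition pB) eB; rewrite -subset0.
    by rewrite -(setICr S) subsetI eS BS.
  by rewrite (EG G1) // E12 -EG.
rewrite -(card_in_imset injU); apply: eq_card => P; apply/idP/imsetP => [|[G]].
  by move=> /splitP[EP _ [_ GY]]; exists (P ::&: S).
rewrite inE => /andP[pG fG] ->; rewrite inE.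
have -> : pairing setT (B :|: G).
  rewrite -(setUCr S) setUC; apply: pairingU => //.
  by rewrite -setI_eq0 setIC setICr.
rewrite traceE // fB fG /= monochromaticU -andbA; apply/and3P; split.
- apply/monochromaticP => e i j /BS/subsetP eS /eS + /eS.
  by rewrite !inE /c => /negbTE-> /negbTE->.
- apply/monochromaticP => e i j /(sub_neq0 _ _ pG)[/subsetP eS _] /eS + /eS.
  by rewrite /c => -> ->.
apply/eqP/setP => e; rewrite !inE.
case eB: (e \in B) => /=; first by rewrite BS.
by apply/andP => -[/(sub_neq0 _ _ pG)[_ /negP]].
Qed.

End Count.

(** This is [sum_monochromatic] with y = 1: each block chooses among the n values [Some i], and
    [None] marks the vertices off [S]. *)
Lemma card_monochromatic n S Q : partition Q S ->
  #|[set f : {ffun T -> option 'I_n} | has_support None S f && monochromatic Q f]|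
  = n ^ #|Q|.
Proof.
move=> QS; have := @sum_monochromatic _ nat (option 'I_n) None (fun=> 1%R) S _ QS.
rewrite [X in X = _](eq_bigr (fun=> 1%R)) => [|f _]; last by rewrite big1.
rewrite [X in _ = X](eq_bigr (fun=> n%:R%R)) => [|e _]; last first.
  rewrite (eq_bigr (fun=> 1%R)) => [|l _]; last by rewrite expr1n.
  rewrite sumr_const; congr (_ *+ _)%R.
  by move: (cardC1 (None : option 'I_n)); rewrite card_option card_ord.
rewrite sumr_const prodr_const -natrX !natn => <-.
by apply: eq_card => f; rewrite inE.
Qed.

(** By [card_monochromatic_pairings] the product counts the pairings of [S] on whose pairs [f] is
    constant; the factor of [None] is 1, as [f] avoids [None] on [S]. *)
Definition wick_sum n S Q : nat :=
  \sum_(f : {ffun T -> option 'I_n} | has_support None S f && monochromatic Q f)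
    \prod_(l : option 'I_n) gaussian_moment #|[set v in S | f v == l]|.

(** The power of n is the number of functions [f] constant on the traces; the couples (P, f) are
    then counted by [f] first and by the black pairs of [P] next. *)
Lemma sum_pairings_traces n D S : pairing setT D ->
  \sum_(P | pairing setT P && monochromatic P (mem S)) n ^ #|traces (D :|: P) S| =
  \sum_(B | pairing (~: S) B) wick_sum n S (traces (D :|: B) S).
Proof.
rewrite /wick_sum => pD.
transitivity (\sum_(f : {ffun T -> option 'I_n} | has_support None S f)
  #|[set P | [&& pairing setT P, monochromatic P (mem S) &
       monochromatic (traces (D :|: P) S) f]]|).
  transitivity (\sum_(P | pairing setT P && monochromatic P (mem S))
     \sum_(f : {ffun T -> option 'I_n} | has_support None S f)
       (monochromatic (traces (D :|: P) S) f : nat)).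
    apply: eq_bigr => P _; rewrite -big_mkcondr.
    rewrite -(card_monochromatic n (traces_partition (D :|: P) S)) -sum1_card.
    by apply: eq_bigl => f; rewrite inE.
  rewrite exchange_big /=; apply: eq_bigr => f _.
  rewrite -sum1_card -big_mkcondr; apply: eq_bigl => P.
  by rewrite inE andbA.
rewrite [RHS](exchange_big_dep (fun f : {ffun T -> option 'I_n} => has_support None S f)) /=; last first.
  by move=> B f _ /andP[].
apply: eq_bigr => f fS.
rewrite -sum1_card (partition_big (black_pairs S) (pairing (~: S))) /=; last first.
  move=> P; rewrite inE => /and3P[pP cP _].
  rewrite -[~: S]setTI; apply: pairing_restrict => // e eP.
  by rewrite setCK orbC (monochromatic_split pP cP).
rewrite [RHS]big_mkcondr /=; apply: eq_bigr => B pB.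
rewrite sum1dep_card -card_monochromatic_pairings.
have := card_pairs_over_black D pB fS; rewrite fS /=.
case: ifP => _; rewrite ?mul1n ?mul0n => <-; apply: eq_card => P;
  by rewrite !inE -!andbA.
Qed.

End BarbellSum.

(** * Barbell graphs *)

Section BarbellGraphs.
Variable m : nat.
Implicit Types (G : colored_system m) (s : {perm Xi m}).

Lemma barbells_pairing : pairing [set: Xi m] (barbells m).
Proof.
(* The ends of barbell l are 2l and 2l+1, written b + 2l with a bit b. *)
have in_lt (l : 'I_m) (b : bool) : b + l.*2 < m.*2.
  by rewrite (leq_trans (_ : _ < l.+1.*2)) ?leq_double // doubleS !ltnS; case: b.
have E (l : 'I_m) : [set i : Xi m | i./2 == l] =
    set1 (Ordinal (in_lt l false)) :|: set1 (Ordinal (in_lt l true)).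
  apply/setP => i; rewrite !inE -!val_eqE /= add0n add1n.
  apply/eqP/orP => [<-|[] /eqP ->].
  - rewrite -[X in X == _](odd_double_half i) -[X in _ \/ X == _](odd_double_half i).
    by case: (odd i); [right|left]; rewrite add0n || rewrite add1n.
  - by rewrite doubleK.
  - exact: (half_bit_double l true).
apply/andP; split; last first.
  by apply/forall_inP => e /imsetP[l _ ->]; rewrite E cards2 -val_eqE /= add0n add1n neq_ltn ltnSn.
apply/and3P; split.
- rewrite eqEsubset subsetT; apply/subsetP => i _.
  have il : i./2 < m by rewrite -ltn_double (leq_ltn_trans _ (ltn_ord i)) // -[leqRHS]odd_double_half leq_addl.
  apply/bigcupP; exists [set j : Xi m | j./2 == Ordinal il]; rewrite ?inE //.
  by apply/imsetP; exists (Ordinal il).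
- apply/trivIsetP => _ _ /imsetP[k _ ->] /imsetP[l _ ->] kl.
  rewrite -setI_eq0; apply: contraNT kl => /set0Pn[i /setIP[]].
  by rewrite !inE => /eqP -> /eqP/val_inj ->.
- by apply/imsetP => -[l _] /setP/(_ (Ordinal (in_lt l false))); rewrite !inE /= add0n doubleK eqxx.
Qed.

Definition green_vertices G := [set i | green G i].

Lemma in_barbell_graphs G : (G \in barbell_graphs m) =
  pairing [set: Xi m] (pairs G) && monochromatic (pairs G) (green G).
Proof.
rewrite inE /pairing -andbA; congr (_ && _).
apply/forall_inP/andP => [cG|[/forall_inP c2 /forall_inP cG] e eG]; last first.
  by rewrite c2 ?cG.
by split; apply/forall_inP => e /cG/andP[].
Qed.

(** A component with a green vertex is determined by its nonempty trace on the green vertices. *)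
Lemma green_componentsE G :
  green_components G = #|traces (edges G) (green_vertices G)|.
Proof.
rewrite /green_components; set K := [set _ in _ | _]; set S := green_vertices G.
have CP : partition (components G) [set: Xi m] := traces_partition _ _.
have tC := partition_trivIset CP.
have injS : {in K &, injective (fun A => A :&: S)}.
  move=> A B; rewrite !inE => /andP[AC /exists_inP[i iA gi]] /andP[BC _] AB.
  have iB : i \in B by apply: (subsetP (subsetIl B S)); rewrite -AB !inE iA.
  by rewrite -(def_pblock tC AC iA) (def_pblock tC BC iB).
rewrite -(card_in_imset injS); apply: eq_card => A; apply/imsetP/imsetP.
  move=> [B /setIdP[/imsetP[v _ ->]] /exists_inP[i]]; rewrite !inE /= => vi gi ->.
  exists i; first by rewrite inE.
  apply/setP => j; rewrite !inE /= andbC; congr (_ && _).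
  exact: (same_connect (@connect_adjacent_sym _ (edges G)) vi).
move=> [v vS ->]; exists [set j | connect (bg_adjacent G) v j].
  rewrite inE; apply/andP; split.
    by apply/imsetP; exists v => //; apply/setP => j; rewrite !inE.
  by apply/exists_inP; exists v; rewrite !inE ?connect0 // in vS *.
by apply/setP => j; rewrite !inE andbC.
Qed.

Lemma sum_barbell_graphs n :
  \sum_(G in barbell_graphs m) n ^ green_components G =
  \sum_(S : {set Xi m}) \sum_(B | pairing (~: S) B)
    wick_sum n S (traces (barbells m :|: B) S).
Proof.
(* Colourings are reindexed by their sets of green vertices. *)
pose F (S : {set Xi m}) : {ffun Xi m -> bool} := [ffun i => i \in S].
have bF : bijective F.
  exists (fun c : {ffun Xi m -> bool} => [set i | c i]) => [S|c]; first by apply/setP => i; rewrite inE ffunE.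
  by apply/ffunP => i; rewrite ffunE inE.
transitivity (\sum_(c : {ffun Xi m -> bool}) \sum_(P | (c, P) \in barbell_graphs m)
    n ^ green_components (c, P)).
  by rewrite pair_big_dep /=; apply: eq_big => -[c P].
rewrite (reindex F) /=; last exact: onW_bij.
apply: eq_bigr => S _; rewrite -(sum_pairings_traces n S barbells_pairing).
apply: eq_big => P.
  rewrite in_barbell_graphs; congr (_ && _).
  apply: eq_forallb_in => e _; apply: eq_forallb_in => i _.
  by apply: eq_forallb_in => j _; rewrite /green /= !ffunE.
move=> _; rewrite green_componentsE; congr (n ^ #|traces _ _|).
by apply/setP => i; rewrite inE /green ffunE.
Qed.

End BarbellGraphs.

(** * Orbits and stabilisers of the barbell group *)

Section Orbits.
Variable m : nat.
Implicit Types (G : colored_system m) (s : {perm Xi m}).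
Local Notation act := (carry_action m).
Local Notation Bm := (barbell_group m).

Lemma carry_barbell_graphs G s :
  G \in barbell_graphs m -> carry G s \in barbell_graphs m.
Proof.
rewrite !in_barbell_graphs => /andP[/andP[PT /forall_inP P2] /monochromaticP cP].
apply/andP; split; last first.
  apply/monochromaticP => _ i j /imsetP[e eP ->] /imsetP[k ke ->] /imsetP[l le ->].
  by rewrite /green /= !ffunE !permK (cP e k l).
apply/andP; split; last first.
  apply/forall_inP => _ /imsetP[e eP ->]; rewrite card_imset ?P2 //.
  exact: perm_inj.
rewrite (_ : setT = s @: setT); last first.
  by apply/setP => i; rewrite inE; apply/esym/imsetP; exists (s^-1 i)%g; rewrite ?permKV.
by rewrite imset_partition //; apply: perm_inj.
Qed.

(** An element of the barbell group preserves the barbells while [carry] moves the pairs along, so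
    paths map to paths; s^-1 gives the converse. *)
Lemma connect_carry G s i j : s \in Bm ->
  connect (bg_adjacent (carry G s)) (s i) (s j) = connect (bg_adjacent G) i j.
Proof.
have homo G' t k l : t \in Bm -> connect (bg_adjacent G') k l ->
    connect (bg_adjacent (carry G' t)) (t k) (t l).
  rewrite barbell_groupE => /eqP tB /connectP[p kp ->].
  apply/connectP; exists (map t p); last by rewrite last_map.
  rewrite path_map; apply: sub_path kp => x y.
  move=> /adjacentP[e [eE xe ye]]; apply/adjacentP; exists (t @: e).
  rewrite !imset_f //; split=> //; case/setUP: eE => eE; apply/setUP.
    by left; rewrite -tB; apply/imsetP; exists e.
  by right; apply/imsetP; exists e.
move=> sB; apply/idP/idP => [/(homo _ _ _ _ (groupVr sB))|]; last exact: homo.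
by rewrite !permK -[carry G s]/(act G s) -[carry _ _]/(act _ _) actK.
Qed.

(** The images of green components are green components, which gives one inequality; s^-1 gives the
    other. *)
Lemma green_components_carry G s : s \in Bm ->
  green_components (carry G s) = green_components G.
Proof.
have le_card G' t : t \in Bm ->
    (green_components G' <= green_components (carry G' t))%N.
  move=> tB; rewrite /green_components -(card_imset _ (imset_inj (@perm_inj _ t))).
  apply/subset_leq_card/subsetP => K' /imsetP[A /setIdP[/imsetP[i _ ->]]].
  move=> /exists_inP[j /setIdP[_ ij] gj] ->.
  apply/setIdP; split; last first.
    by apply/exists_inP; exists (t j); rewrite ?imset_f ?inE // /green ffunE permK.
  apply/imsetP; exists (t i); rewrite ?inE //; apply/setP => k.
  rewrite -[k](permKV t) mem_imset ?inE ?connect_carry //; exact: perm_inj.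
move=> sB; apply/eqP; rewrite eqn_leq le_card // andbT.
have := le_card (carry G s) _ (groupVr sB).
by rewrite -[carry G s]/(act G s) -[carry _ _]/(act _ _) actK.
Qed.

(** The labelled sum is split into orbits; n^N is constant on each, and an orbit has |B_m| / |Aut|
    elements. *)
Lemma sum_barbell_classes (R : numFieldType) n
    (rep : {set colored_system m} -> colored_system m) :
    (forall C, C \in barbell_graph_classes m -> rep C \in C) ->
  (\sum_(C in barbell_graph_classes m)
     n%:R ^+ green_components (rep C) / #|barbell_aut (rep C)|%:R =
   #|Bm|%:R^-1 * (\sum_(G in barbell_graphs m) n ^ green_components G)%:R :> R)%R.
Proof.
move=> rep_in.
have actB : [acts Bm, on barbell_graphs m | act].
  apply/actsP => s sB G; apply/idP/idP => [|]; last exact: carry_barbell_graphs.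
  by move/(carry_barbell_graphs s^-1%g); rewrite -[carry _ _]/(act _ _) actK.
rewrite (set_partition_big _ (orbit_partition actB)) /= natr_sum mulr_sumr.
apply: eq_bigr => C CC.
have EC : C = orbit act Bm (rep C).
  case/imsetP: (CC) => G _ EG; have := rep_in C CC.
  by rewrite {2 3}EG => /orbit_eqP ->.
rewrite (eq_bigr (fun=> n ^ green_components (rep C))%N); last first.
  move=> G GC; have /orbitP[s sB <-] : G \in orbit act Bm (rep C) by rewrite -EC.
  by congr (n ^ _); apply: green_components_carry.
rewrite sum_nat_const -natrX natrM mulrA mulrC; congr (_ * _)%R.
have := card_orbit_stab act (barbell_group_group m) (rep C).
rewrite -EC -/(barbell_aut _) => <-; rewrite natrM invfM mulrAC mulVf ?mul1r //.
by rewrite pnatr_eq0 -lt0n; apply/card_gt0P; exists (rep C); apply: rep_in.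
Qed.

End Orbits.

(** * Gaussian integrals *)

From mathcomp Require Import all_classical all_reals all_analysis.
From mathcomp Require Import measurable_realfun ring.

Import Order.TTheory GRing.Theory Num.Theory.
Import numFieldNormedType.Exports.

Local Open Scope classical_set_scope.
Local Open Scope ring_scope.

Section GaussianMoments.
Variable R : realType.
Local Notation mu := (@lebesgue_measure R).

(** Integrability travels with the value because additivity, Fubini's theorem and change of
    variables all consume it. *)
Definition has_integral d (T : measurableType d) (nu : {measure set T -> \bar R})
    (f : T -> R) (r : R) :=
  nu.-integrable setT (EFin \o f) /\ (\int[nu]_x (f x)%:E = r%:E)%E.

Definition gauss_weight (x : R) : R := expR (- (x ^+ 2 / 2)).
Definition gauss_monomial a (x : R) := x ^+ a * gauss_weight x.

(** With t = x^2/4, e^t dominates t^(a+1)/(a+1)!, a multiple of |x|^(2a+2), which exceeds |x|^a when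
    |x| > 1; otherwise |x|^a <= 1. *)
Lemma pow_expR_bound a (x : R) :
  `|x| ^+ a * expR (- (x ^+ 2 / 4)) <= 1 + 4 ^+ a.+1 * a.+1`!%:R.
Proof.
set K : R := 4 ^+ a.+1 * _.
have K0 : 0 < K by rewrite mulr_gt0 ?exprn_gt0 ?ltr0n ?fact_gt0.
have t0 : 0 <= x ^+ 2 / 4 by rewrite divr_ge0 ?sqr_ge0.
rewrite expRN ler_pdivrMr ?expR_gt0 //.
have := expR_ge1Dxn a t0.
have -> : (x ^+ 2 / 4) ^+ a.+1 / a.+1`!%:R = `|x| ^+ (a.+1).*2 / K.
  rewrite expr_div_n -exprM -[in RHS]mul2n /K.
  rewrite exprM -(real_normK (num_real x)) -exprM.
  by rewrite -mulrA -invfM.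
move=> ge_e; rewrite mulrDl mul1r.
have [x1|x1] := leP `|x| 1.
  apply: (@le_trans _ _ 1); first by rewrite exprn_ile1.
  apply: (@le_trans _ _ (expR (x ^+ 2 / 4))); last by rewrite lerDl mulr_ge0 ?expR_ge0 ?(ltW K0).
  by apply: le_trans ge_e; rewrite lerDl divr_ge0 ?exprn_ge0 ?normr_ge0 ?(ltW K0).
apply: (@le_trans _ _ (K * expR (x ^+ 2 / 4))); last by rewrite lerDr expR_ge0.
rewrite mulrC -ler_pdivrMr //; apply: le_trans (ge_e).
apply: (@le_trans _ _ (`|x| ^+ a.+1.*2 / K)); last by rewrite lerDr.
rewrite ler_pM2r ?invr_gt0 // ler_weXn2l ?ltW //.
by rewrite -addnn leqW // leq_addr.
Qed.

Lemma gauss_weightE x : gauss_weight x = expR (- (x ^+ 2 / 4)) * expR (- (x ^+ 2 / 4)).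
Proof. by rewrite -expRD; congr expR; field. Qed.

Lemma continuous_gauss_monomial a : continuous (gauss_monomial a).
Proof.
move=> x; apply: cvgM; first exact: exprn_continuous.
apply: continuous_comp; last exact: continuous_expR.
apply: cvgN; apply: cvgM; first exact: exprn_continuous.
exact: cvg_cst.
Qed.

Lemma measurable_gauss_monomial a : measurable_fun setT (gauss_monomial a).
Proof. by apply: measurable_realfun.continuous_measurable_fun; apply: continuous_gauss_monomial. Qed.

Lemma has_integral_gauss_weight :
  exists2 Z : R, 0 < Z & has_integral mu (gauss_monomial 0) Z.
Proof.
have peak0 := @normal_peak_gt0 R 1 (oner_neq0 _).
exists (normal_peak 1)^-1; first by rewrite invr_gt0.
have E x : (gauss_monomial 0 x)%:E =
    ((normal_peak 1)^-1%:E * (normal_pdf 0 1 x)%:E)%E.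
  rewrite normal_pdfE ?oner_neq0 // /normal_fun -EFinM mulKf ?gt_eqF //.
  rewrite /gauss_monomial /gauss_weight expr0 mul1r; congr (expR _)%:E.
  by rewrite subr0 expr1n mulNr.
have I := @integrable_normal_pdf R 0 1; split.
  have := integrableZl measurableT (normal_peak 1)^-1 I.
  by apply: eq_integrable => // x _; rewrite /= E.
under eq_integral do rewrite E.
by rewrite integralZl // integral_normal_pdf mule1.
Qed.

(** One half of the weight absorbs x^a by [pow_expR_bound]; the other, e^(-x^2/4), is up to its peak
    the normal density of variance 2. *)
Lemma integrable_gauss_monomial a :
  mu.-integrable setT (EFin \o gauss_monomial a).
Proof.
have s0 : Num.sqrt 2 != 0 :> R by rewrite gt_eqF // sqrtr_gt0.
have peak0 := normal_peak_gt0 s0.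
pose C : R := (1 + 4 ^+ a.+1 * a.+1`!%:R) / normal_peak (Num.sqrt 2).
apply: (@le_integrable _ _ _ mu _ measurableT _
    (fun x => C%:E * (normal_pdf 0 (Num.sqrt 2) x)%:E)%E).
- by apply/measurable_EFinP; apply: measurable_gauss_monomial.
- move=> x _; rewrite /= lee_fin /gauss_monomial normrM normrX [X in _ * X]ger0_norm ?expR_ge0 //.
  rewrite gauss_weightE mulrA (le_trans _ (ler_norm _)) //.
  rewrite normal_pdfE // /normal_fun /C mulrA divfK ?gt_eqF //.
  rewrite subr0 sqr_sqrtr // mulNr -[2 *+ 2]/(2 + 2) -natrD.
  by rewrite ler_pM2r ?expR_gt0 // pow_expR_bound.
- by apply: integrableZl => //; apply: integrable_normal_pdf.
Qed.

End GaussianMoments.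

(** * Moments of the Gaussian weight by integration by parts *)

Section GaussianRecursion.
Variable R : realType.
Local Notation mu := (@lebesgue_measure R).

Lemma is_derive_gauss_monomial a (x : R) :
  is_derive x 1 (gauss_monomial (R := R) a)
    (a%:R * gauss_monomial a.-1 x - gauss_monomial a.+1 x).
Proof.
have did : is_derive x (1 : R) (@id R) 1 by exact: is_derive_id.
have dq : is_derive x (1 : R) (fun y : R => - (y ^+ 2 / 2)) (- x).
  have -> : (fun y : R => - (y ^+ 2 / 2)) = - ((2^-1 : R) *: (@id R ^+ 2)).
    by apply/funext => y; rewrite /= mulrC.
  apply: is_derive_eq; rewrite /GRing.scale /=; by field.
have dw : is_derive x (1 : R) (gauss_weight (R := R)) (gauss_weight x * - x).
  exact: (is_derive1_comp (is_derive_expR _) dq).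
have dp : is_derive x (1 : R) (@id R ^+ a) (a%:R * x ^+ a.-1).
  by apply: is_derive_eq; rewrite /GRing.scale /= mulr1.
have -> : gauss_monomial (R := R) a = (@id R ^+ a) * gauss_weight (R := R).
  by apply/funext => y; rewrite /= /gauss_monomial; congr (_ * _); rewrite exprfctE.
apply: (is_derive_eq (is_deriveM dp dw)).
rewrite /GRing.scale /= /gauss_monomial exprS exprfctE; ring.
Qed.


(** Obtained from the bound for the power a+1; it will make the boundary terms vanish at
    infinity. *)
Lemma gauss_monomial_le a (x : R) : 0 < `|x| ->
  `|gauss_monomial a x| <= (1 + 4 ^+ a.+2 * a.+2`!%:R) * `|x|^-1.
Proof.
move=> x0; rewrite ler_pdivlMr // /gauss_monomial normrM normrX mulrAC -exprSr.
rewrite [X in _ * X]ger0_norm ?expR_ge0 //; apply: le_trans (pow_expR_bound a.+1 x).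
rewrite ler_wpM2l ?exprn_ge0 // ler_expR lerN2 ler_wpM2l ?sqr_ge0 //.
by rewrite lef_pV2 ?posrE // ler_nat.
Qed.

Let dgauss a (x : R) : R := a%:R * gauss_monomial a.-1 x - gauss_monomial a.+1 x.

Let continuous_dgauss a : continuous (dgauss a).
Proof.
move=> x; apply: cvgB; last exact: continuous_gauss_monomial.
by apply: cvgM; [exact: cvg_cst|exact: continuous_gauss_monomial].
Qed.

Let integrable_dgauss a : mu.-integrable setT (EFin \o dgauss a).
Proof.
have := integrableB measurableT
  (integrableZl measurableT a%:R (integrable_gauss_monomial R a.-1))
  (integrable_gauss_monomial R a.+1).
by apply: eq_integrable => // x _; rewrite /= /dgauss EFinB EFinM.
Qed.

(** The integrand is the derivative of [gauss_monomial a], so over a symmetric interval its integral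
    is a difference of boundary values, which tends to 0; by dominated convergence it also tends to
    the whole integral. *)
Let integral_dgauss a : (\int[mu]_x (dgauss a x)%:E = 0)%E.
Proof.
(* The shift to N+1 keeps the interval nondegenerate and matches [harmonic N], which is 1/(N+1). *)
pose D (N : nat) : set (measurableTypeR R) := `[- N.+1%:R, N.+1%:R]%classic.
pose F := gauss_monomial (R := R) a.
have ftc N : (\int[mu]_(x in D N) (dgauss a x)%:E = (F N.+1%:R - F (- N.+1%:R))%:E)%E.
  rewrite EFinB; apply: continuous_FTC2.
  - by rewrite gtrN ?ltr0n.
  - by apply: continuous_subspaceT; apply: continuous_dgauss.
  - split.
    + by move=> x _; have [] := is_derive_gauss_monomial a x.
    + by apply: cvg_at_right_filter; apply: continuous_gauss_monomial.
    + by apply: cvg_at_left_filter; apply: continuous_gauss_monomial.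
  - move=> x _; rewrite derive1E.
    by have dF := is_derive_gauss_monomial a x; rewrite derive_val.
have lim_int : (\int[mu]_(x in D N) (dgauss a x)%:E)%E @[N --> \oo]
    --> (\int[mu]_x (dgauss a x)%:E)%E.
  have mD N : measurable (D N) by exact: measurable_itv.
  have iD N : mu.-integrable setT ((EFin \o dgauss a) \_ (D N)).
    have iN := integrableS measurableT (mD N) (@subsetT _ _) (integrable_dgauss a).
    exact: (integrable_mkcond (mu := mu) (EFin \o dgauss a) (mD N)).1.
  under eq_fun do rewrite integral_mkcond.
  have [] := @dominated_convergence _ _ _ mu setT measurableT
    (fun N => (EFin \o dgauss a) \_ (D N)) (EFin \o dgauss a) (abse \o (EFin \o dgauss a)).
  - by move=> N; apply: measurable_int (iD N).
  - by apply: measurable_int (integrable_dgauss a).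
  - apply: aeW => x _; apply: cvg_near_cst; near=> N.
    rewrite patchT // inE /D /= in_itv /= -ler_norml.
    apply: (@le_trans _ _ N%:R); last by rewrite ler_nat.
    by near: N; apply: nbhs_infty_ger.
  - by apply: integrable_abse; apply: integrable_dgauss.
  - by apply: aeW => x N _; rewrite /patch; case: ifP => // _; rewrite abse0 abse_ge0.
  - by [].
have lim0 : (\int[mu]_(x in D N) (dgauss a x)%:E)%E @[N --> \oo] --> 0%E.
  under eq_fun do rewrite ftc.
  apply: cvg_EFin; first by near=> N.
  pose C : R := 1 + 4 ^+ a.+2 * a.+2`!%:R.
  have bound N : `|F N.+1%:R - F (- N.+1%:R)| <= (C + C) * harmonic N.
    apply: le_trans (ler_normB _ _) _; rewrite mulrDl lerD //.
      by have := @gauss_monomial_le a N.+1%:R; rewrite normr_nat; apply; rewrite ltr0n.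
    by have := @gauss_monomial_le a (- N.+1%:R); rewrite normrN normr_nat; apply; rewrite ltr0n.
  have limC : (C + C) * harmonic N @[N --> \oo] --> (0 : R).
    rewrite -[0](mulr0 (C + C)); apply: cvgM; first exact: cvg_cst.
    exact: cvg_harmonic.
  apply: (squeeze_cvgr (f := fun N => - ((C + C) * harmonic N)) _ _ limC).
    by near=> N; rewrite -ler_norml; apply: bound.
  by rewrite -[0]oppr0; apply: cvgN.
exact: (cvg_unique _ lim_int lim0).
Unshelve. all: by end_near. Qed.

Lemma has_integral_gauss_monomial :
  exists2 Z : R, 0 < Z &
    forall a, has_integral mu (gauss_monomial a) ((gaussian_moment a)%:R * Z).
Proof.
have [Z Z0 [_ IZ]] := has_integral_gauss_weight R; exists Z => // a.
split; first exact: integrable_gauss_monomial.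
pose c b := fine (\int[mu]_x (gauss_monomial (R := R) b x)%:E)%E.
have cE b : (\int[mu]_x (gauss_monomial b x)%:E)%E = (c b)%:E.
  by rewrite fineK // integrable_fin_num //; apply: integrable_gauss_monomial.
(* The vanishing integral of the derivative is the recursion of [gaussian_moment]; for b = 0 the
   coefficient kills the term at [b.-1]. *)
have rec b : c b.+1 = b%:R * c b.-1.
  have := integral_dgauss b; rewrite /dgauss.
  under eq_integral do rewrite EFinB EFinM.
  rewrite integralB //; last 2 first.
  - by apply: integrableZl => //; apply: integrable_gauss_monomial.
  - exact: integrable_gauss_monomial.
  rewrite integralZl //; last exact: integrable_gauss_monomial.
  by rewrite !cE -EFinM -EFinB => -[] /eqP; rewrite subr_eq0 => /eqP.
rewrite cE; congr _%:E; elim/ltn_ind: a => -[_|[_|a IH]].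
- by apply: EFin_inj; rewrite -cE IZ mul1r.
- by rewrite rec !mul0r.
- by rewrite rec IH //= natrM mulrA.
Qed.

End GaussianRecursion.

(** * Integrals of sums, products and push-forwards *)

Section HasIntegral.
Context d (T : measurableType d) (R : realType) (nu : {measure set T -> \bar R}).

Lemma eq_has_integral f g r : f =1 g -> has_integral nu f r -> has_integral nu g r.
Proof. by move=> /funext <-. Qed.

Lemma has_integralD f g r s : has_integral nu f r -> has_integral nu g s ->
  has_integral nu (fun x => f x + g x) (r + s).
Proof.
move=> [If Ef] [Ig Eg]; split.
  have := integrableD measurableT If Ig.
  by apply: eq_integrable => // x _; rewrite /= EFinD.
under eq_integral do rewrite EFinD.
by rewrite integralD // Ef Eg.
Qed.

Lemma has_integral_sum (I : Type) (s : seq I) (P : pred I) (f : I -> T -> R) r :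
  (forall i, P i -> has_integral nu (f i) (r i)) ->
  has_integral nu (fun x => \sum_(i <- s | P i) f i x) (\sum_(i <- s | P i) r i).
Proof.
move=> fr; elim: s => [|i s IH].
  rewrite big_nil; apply: (@eq_has_integral (cst 0)) => [x|]; first by rewrite big_nil.
  by split; [exact: integrable0|exact: integral0].
rewrite big_cons; case: ifP => Pi.
  apply: eq_has_integral (has_integralD (fr i Pi) IH) => x.
  by rewrite big_cons Pi.
by apply: eq_has_integral IH => x; rewrite big_cons Pi.
Qed.

Lemma has_integral_Rintegral f r : has_integral nu f r ->
  (\int[nu]_x f x)%R = r.
Proof. by move=> [_ Ef]; rewrite /Rintegral Ef. Qed.

End HasIntegral.

Section ProductIntegral.
Context d1 d2 (T1 : measurableType d1) (T2 : measurableType d2) (R : realType).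
Variables (m1 : {sigma_finite_measure set T1 -> \bar R}).
Variables (m2 : {sigma_finite_measure set T2 -> \bar R}).

Lemma has_integral_prod (f : T1 -> R) (g : T2 -> R) r s :
  has_integral m1 f r -> has_integral m2 g s ->
  has_integral (m1 \x m2)%E (fun z => f z.1 * g z.2) (r * s).
Proof.
move=> [If Ef] [Ig Eg].
have mf : measurable_fun setT f by apply/measurable_EFinP; apply: measurable_int If.
have mg : measurable_fun setT g by apply/measurable_EFinP; apply: measurable_int Ig.
have mfg : measurable_fun setT (EFin \o (fun z : T1 * T2 => f z.1 * g z.2)).
  apply/measurable_EFinP; apply: measurable_funM.
    exact: (measurableT_comp mf measurable_fst).
  exact: (measurableT_comp mg measurable_snd).
have Ifg : (m1 \x m2)%E.-integrable setT (EFin \o (fun z : T1 * T2 => f z.1 * g z.2)).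
  apply/integrable12ltyP => //.
  under eq_integral => x _.
    under eq_integral do rewrite /= normrM EFinM.
    rewrite ge0_integralZl//; last first.
      by do 2 apply: measurableT_comp => //.
    over.
  rewrite /= ge0_integralZr//; last 2 first.
  - by do 2 apply: measurableT_comp => //.
  - by apply: integral_ge0.
  rewrite lte_mul_pinfty // ?integral_ge0 //.
  - by rewrite ge0_fin_numE ?integral_ge0 //; have /integrableP[] := If.
  - by have /integrableP[] := Ig.
split=> //; rewrite -integral12_prod_meas1 // /fubini_F.
rewrite (eq_integral (fun x => (f x)%:E * s%:E)%E) => [|x _].
  by rewrite integralZr // Ef.
rewrite /=; under eq_integral do rewrite EFinM.
by rewrite integralZl // Eg.
Qed.

End ProductIntegral.

Lemma has_integral_pushforward d1 d2 (X : measurableType d1)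
    (Y : measurableType d2) (R : realType) (phi : X -> Y)
    (mu : {measure set X -> \bar R}) (nu : {measure set Y -> \bar R})
    (f : Y -> R) (r : R) :
    measurable_fun setT phi -> (forall A, nu A = mu (phi @^-1` A)) ->
    measurable_fun setT f ->
  has_integral mu (f \o phi) r -> has_integral nu f r.
Proof.
move=> mphi nuE mf [If Ef].
have mEf : measurable_fun setT (EFin \o f) by apply/measurable_EFinP.
have intE (h : Y -> \bar R) : measurable_fun setT h -> mu.-integrable setT (h \o phi) ->
    (\int[nu]_y h y = \int[mu]_x (h (phi x)))%E.
  move=> mh Ih; have := integral_pushforward mphi (D := setT) mh.
  rewrite preimage_setT => /(_ mu Ih measurableT) <-.
  by apply: eq_measure_integral => A mA _; rewrite nuE.
split; last by rewrite intE.
apply/integrableP; split=> //.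
rewrite intE; first by have /integrableP[] := If.
  exact: measurableT_comp.
exact: (integrable_abse If).
Qed.

Section GaussianRows.
Variable R : realType.

Lemma measurable_prod_coord n (g : 'I_n -> R -> R) :
  (forall i, measurable_fun setT (g i)) ->
  measurable_fun setT (fun x : 'rV[R]_n => \prod_(i < n) g i (x ord0 i)).
Proof.
move=> mg; apply: measurable_prod => i _.
apply: (measurableT_comp (mg i)).
exact: measurable_row_coord.
Qed.

(** Induction along the construction of [lebesgue_row]: the first coordinate splits off by Fubini
    through [row_cons], and for n = 0 the Dirac mass integrates the empty product to 1. *)
Lemma has_integral_row n (g : 'I_n -> R -> R) (r : 'I_n -> R) :
  (forall i, has_integral (@lebesgue_measure R) (g i) (r i)) ->
  has_integral (lebesgue_row R n) (fun x => \prod_(i < n) g i (x ord0 i))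
    (\prod_(i < n) r i).
Proof.
elim: n g r => [|n IH] g r gr.
  rewrite big_ord0; split.
    apply: (@eq_integrable _ _ _ _ _ measurableT (cst 1%E)) => [x _|].
      by rewrite /= big_ord0.
    by apply: finite_measure_integrable_cst.
  under eq_integral do rewrite big_ord0.
  by rewrite integral_cst // /= diracT mule1.
have mg i : measurable_fun setT (g i).
  by case: (gr i) => + _ => /measurable_int/measurable_EFinP.
pose mu : {measure set (measurableTypeR R * 'rV[R]_n) -> \bar R} :=
  ((@lebesgue_measure R) \x lebesgue_row R n)%E.
apply: (@has_integral_pushforward _ _ (measurableTypeR R * 'rV[R]_n)%type _ R
  (@row_cons R n) mu (lebesgue_row R n.+1)).
- exact: measurable_row_cons.
- by [].
- exact: measurable_prod_coord.
rewrite big_ord_recl; apply: eq_has_integral; last first.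
  apply: has_integral_prod (gr ord0) (IH (fun i => g (lift ord0 i)) _ _).
  by move=> i; apply: gr.
move=> z /=; rewrite [RHS]big_ord_recl row_cons0; congr (_ * _).
by apply: eq_bigr => i _; rewrite row_consS.
Qed.

End GaussianRows.

Local Close Scope classical_set_scope.

(** * The spin factor *)

Section SpinPowers.
Variables (R : realType) (n : nat).
Implicit Types (x : spin R n).

Lemma spin_powSS x k : spin_pow x k.+2 = spin_mul x (spin_pow x k.+1).
Proof. by []. Qed.

Lemma dot_ge0 (v : 'rV[R]_n) : 0 <= dot v v.
Proof. by apply: sumr_ge0 => i _; rewrite -expr2 sqr_ge0. Qed.

(* x0 + |v| and x0 - |v| are the eigenvalues of (x0, v). *)
Lemma spin_pow_eigen x k (r := Num.sqrt (dot x.2 x.2)) :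
  exists a b, [/\ spin_pow x k.+1 = (a, b *: x.2),
    a + b * r = (x.1 + r) ^+ k.+1 & a - b * r = (x.1 - r) ^+ k.+1].
Proof.
have r2 : r * r = dot x.2 x.2 by rewrite -expr2 sqr_sqrtr ?dot_ge0.
have dotZr c : dot x.2 (c *: x.2) = c * (r * r).
  by rewrite r2 mulr_sumr; apply: eq_bigr => i _; rewrite mxE mulrCA.
elim: k => [|k [a [b [E Ep Em]]]].
  by exists x.1, 1; rewrite scale1r mul1r !expr1; case: (x).
exists (x.1 * a + b * (r * r)), (x.1 * b + a); split.
- by rewrite spin_powSS E /spin_mul /= dotZr scalerA -scalerDl.
- by rewrite exprS -Ep; ring.
- by rewrite exprS -Em; ring.
Qed.

(** The binomial theorem before subsets are grouped by size; [T] will be the set of vertices. *)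
Lemma exprD_sum_sets (T : finType) (a b : R) :
  (b + a) ^+ #|T| = \sum_(S : {set T}) a ^+ #|S| * b ^+ #|~: S|.
Proof.
rewrite addrC -prodr_const bigA_distr; apply: eq_bigr => S _.
rewrite (bigID (mem S)) /=; congr (_ * _).
  by rewrite (eq_bigr (fun=> a)) ?prodr_const // => i ->.
rewrite (eq_bigr (fun=> b)) => [|i /negbTE -> //].
by rewrite -prodr_const; apply: eq_bigl => i; rewrite inE.
Qed.

(** The trace of the power is half the sum of the powers of x_0 + r and x_0 - r, with r = |x|; in
    their expansions over subsets the odd powers of r cancel. *)
Lemma spin_tr_pow x (T : finType) : (0 < #|T|)%N ->
  spin_tr (spin_pow x #|T|) =
  \sum_(S : {set T} | ~~ odd #|S|) x.1 ^+ #|~: S| * dot x.2 x.2 ^+ #|S|./2.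
Proof.
case k0 : #|T| => [//|k] _; have [a [b [E Ep Em]]] := spin_pow_eigen x k.
set r := Num.sqrt _ in Ep Em; rewrite E /spin_tr /=.
have two0 : (2 : R) != 0 by rewrite pnatr_eq0.
apply: (mulfI two0).
have -> : 2 * a = (x.1 + r) ^+ k.+1 + (x.1 - r) ^+ k.+1 by rewrite -Ep -Em; ring.
rewrite -k0 !exprD_sum_sets -big_split mulr_sumr [RHS]big_mkcond /=.
apply: eq_bigr => S _; rewrite exprNn -signr_odd; case: ifP => [eS|/negbFE ->].
  rewrite (negbTE eS) expr0 mul1r [in LHS](_ : r ^+ #|S| = dot x.2 x.2 ^+ #|S|./2); first by ring.
  rewrite -{1}(even_halfK eS) -mul2n exprM sqr_sqrtr //; exact: dot_ge0.
by rewrite expr1 mulN1r mulNr subrr.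
Qed.

End SpinPowers.

(** * Gaussian integrals over the spin factor *)

Section SpinMoments.
Variables (R : realType) (n : nat) (T : finType).
Implicit Types (S : {set T}) (Q B D : {set {set T}}).

Definition gauss_row (v : 'rV[R]_n) : R := \prod_(i < n) gauss_weight (v ord0 i).

Lemma big_option (X : Type) (idx : X) (op : Monoid.com_law idx)
    (F : option 'I_n -> X) :
  \big[op/idx]_(l : option 'I_n) F l =
  op (F None) (\big[op/idx]_(i < n) F (Some i)).
Proof.
rewrite (bigD1 None) //=; congr (op _ _).
rewrite (reindex_omap (@Some 'I_n) id) /=; last by case.
by apply: eq_bigl => i; rewrite eqxx.
Qed.

(** The value at [None] is a default: a function with support [S] does not take it on [S]. *)
Let coord (v : 'rV[R]_n) (l : option 'I_n) : R :=
  if l is Some i then v ord0 i else 0.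

(** Each pair contributes a factor sum_i v_i^2 and picks one coordinate in it, which amounts to a
    function constant on the pairs. *)
Lemma dot_exp_card S Q (v : 'rV[R]_n) : pairing S Q ->
  dot v v ^+ #|Q| =
  \sum_(f : {ffun T -> option 'I_n} | has_support None S f && monochromatic Q f)
    \prod_(t in S) coord v (f t).
Proof.
move=> pQ; rewrite sum_monochromatic ?pairing_partition // -prodr_const.
apply: eq_bigr => e eQ; rewrite (pairing_card2 pQ eQ) big_mkcond big_option /=.
by rewrite add0r; apply: eq_bigr => i _; rewrite expr2.
Qed.

Variable Z : R.
Hypothesis Z_gt0 : 0 < Z.
Hypothesis gaussZ : forall a,
  has_integral (@lebesgue_measure R) (gauss_monomial a) ((gaussian_moment a)%:R * Z).

(** The coordinates separate: v_i occurs with exponent the number of [t] in [S] with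
    [f t = Some i]. *)
Lemma has_integral_monomial S (f : {ffun T -> option 'I_n}) : has_support None S f ->
  has_integral (lebesgue_row R n)
    (fun v => (\prod_(t in S) coord v (f t)) * gauss_row v)
    ((\prod_(l : option 'I_n) gaussian_moment #|[set t in S | f t == l]|)%:R * Z ^+ n).
Proof.
move=> /has_supportP fS; pose a i := #|[set t in S | f t == Some i]|.
have := has_integral_row (fun i => gaussZ (a i)).
rewrite big_split prodr_const card_ord -natr_prod big_option /=.
have -> : [set t in S | f t == None] = finset.set0.
  by apply/setP => t; rewrite !inE -(fS t) andNb.
rewrite cards0 mul1n; apply: eq_has_integral => v.
rewrite big_split; congr (_ * _).
rewrite (partition_big f predT) //= big_option [X in _ = X * _]big_pred0 => [|t]; last first.
  by rewrite -(fS t) andNb.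
rewrite mul1r; apply: eq_bigr => i _.
rewrite (eq_bigr (fun=> v ord0 i)) => [|t /andP[_ /eqP -> //]].
by rewrite prodr_const; congr (_ ^+ _); apply: eq_card => t; rewrite !inE.
Qed.

(** The integrand depends on [Q] only through its cardinality, which will show that [wick_sum n S Q]
    is the same for all pairings [Q] of [S]. *)
Lemma has_integral_dot S Q : pairing S Q ->
  has_integral (lebesgue_row R n) (fun v => dot v v ^+ #|Q| * gauss_row v)
    ((wick_sum n S Q)%:R * Z ^+ n).
Proof.
move=> pQ; rewrite /wick_sum natr_sum mulr_suml.
have := @has_integral_sum _ _ _ (lebesgue_row R n) _ (index_enum _)
  (fun f : {ffun T -> option 'I_n} => has_support None S f && monochromatic Q f) _ _
  (fun f fSQ => has_integral_monomial (proj1 (andP fSQ))).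
apply: eq_has_integral => v.
by rewrite (dot_exp_card _ pQ) mulr_suml.
Qed.

Lemma spin_weightE (x : spin R n) : spin_weight x = gauss_weight x.1 * gauss_row x.2.
Proof.
rewrite /gauss_row /gauss_weight -expR_sum -expRD; congr expR.
rewrite sumrN -mulr_suml -opprD -mulrDl /spin_tr /spin_pow /= /spin_mul /= -expr2.
by congr (- ((_ + _) / 2)); apply: eq_bigr => i _; rewrite expr2.
Qed.

Lemma gaussian_moment_even_gt0 a : ~~ odd a -> (0 < gaussian_moment a)%N.
Proof.
elim/ltn_ind: a => -[|[|a]] IH //= oa.
by rewrite muln_gt0 /= IH //; move: oa; rewrite negbK.
Qed.

(** Wick's formula for a constant function, for which every pairing is monochromatic. *)
Lemma card_pairings S : #|[set B | pairing S B]| = gaussian_moment #|S|.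
Proof.
have := card_monochromatic_pairings (fun _ : T => tt) S.
rewrite (big_pred1 tt) => [|[]//]; rewrite (_ : [set v in S | _] = S) => [<-|].
  apply: eq_card => B; rewrite !inE andb_idr // => _.
  by apply/monochromaticP.
by apply/setP => t; rewrite !inE andbT.
Qed.

(** All terms of the sum over [B] agree, and their number is the moment of x_0 of order [#|~: S|];
    Fubini then yields one factor [Z] per coordinate. *)
Lemma has_integral_spin D S : pairing finset.setT D -> ~~ odd #|S| -> ~~ odd #|T| ->
  has_integral (@spin_lebesgue R n)
    (fun x => (x.1 ^+ #|~: S| * dot x.2 x.2 ^+ #|S|./2) * spin_weight x)
    ((\sum_(B | pairing (~: S) B) wick_sum n S (traces (D :|: B) S))%:R * Z ^+ n.+1).
Proof.
move=> pD eS eT.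
have eSc : ~~ odd #|~: S| by rewrite cardsCs finset.setCK oddB ?max_card // (negbTE eS) (negbTE eT).
pose q B := traces (D :|: B) S.
have pq B : pairing (~: S) B -> pairing S (q B) by apply: traces_pairing.
have cq B : pairing (~: S) B -> #|q B| = #|S|./2.
  by move=> /pq/card_pairing ->; rewrite muln2 doubleK.
(* The complement of [S] is even, so it has a pairing [B0], taken as reference. *)
have /card_gt0P[B0] : (0 < #|[set B | pairing (~: S) B]|)%N.
  by rewrite card_pairings gaussian_moment_even_gt0.
rewrite inE => pB0.
(* Both sides times Z^n are values of one and the same integral, and Z^n is nonzero. *)
have same B : pairing (~: S) B -> wick_sum n S (q B) = wick_sum n S (q B0).
  move=> pB; have [_] := has_integral_dot (pq B pB).
  have [_] := has_integral_dot (pq B0 pB0); rewrite !cq // => -> [] /mulIf.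
  rewrite expf_eq0 gt_eqF // andbF => /(_ isT)/eqP; rewrite eqr_nat => /eqP -> //.
rewrite (eq_bigr (fun=> wick_sum n S (q B0))) // sum_nat_const.
have -> : #|pairing (~: S)| = gaussian_moment #|~: S|.
  by rewrite -card_pairings; apply: eq_card => B; rewrite inE.
have := has_integral_prod (gaussZ #|~: S|) (has_integral_dot (pq B0 pB0)).
rewrite natrM exprS cq // mulrACA; apply: eq_has_integral => x.
by rewrite spin_weightE /gauss_monomial mulrACA.
Qed.

Lemma has_integral_spin_weight :
  has_integral (@spin_lebesgue R n) (@spin_weight R n) (Z ^+ n.+1).
Proof.
have := has_integral_prod (gaussZ 0) (has_integral_row (fun i : 'I_n => gaussZ 0)).
rewrite mul1r prodr_const card_ord -exprS; apply: eq_has_integral => x.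
rewrite spin_weightE /gauss_monomial expr0 mul1r; congr (_ * _).
by apply: eq_bigr => i _; rewrite expr0 mul1r.
Qed.

End SpinMoments.

(** Integrating the subset expansion of Tr x^k term by term leaves the common factor Z^(n+1), which
    is the normalising integral. *)
Lemma spin_moment_pairings (R : realType) (n : nat) (T : finType)
    (D : {set {set T}}) : pairing finset.setT D -> (0 < #|T|)%N ->
  spin_moment R n #|T| =
  (\sum_(S : {set T}) \sum_(B | pairing (~: S) B)
     wick_sum n S (traces (D :|: B) S))%:R.
Proof.
move=> pD T0; have [Z Z0 gaussZ] := has_integral_gauss_monomial R.
have eT : ~~ odd #|T| by rewrite -cardsT (card_pairing pD) muln2 odd_double.
rewrite /spin_moment /spin_expectation.
rewrite (has_integral_Rintegral (has_integral_spin_weight n gaussZ)).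
have := has_integral_sum (index_enum _)
  (fun S eS => has_integral_spin n Z0 gaussZ pD (S := S) eS eT).
rewrite -mulr_suml => I.
rewrite (has_integral_Rintegral (eq_has_integral _ I)) => [|x]; last first.
  by rewrite spin_tr_pow // mulr_suml.
rewrite mulfK ?expf_neq0 ?gt_eqF // -natr_sum; congr _%:R.
(* If [S] is odd, so is its complement, which then has no pairing; such [S] contribute 0. *)
rewrite big_mkcond; apply: eq_bigr => S _; case: ifP => // /negbFE oS.
rewrite big_pred0 // => B; apply/negP => pB.
have := card_pairing pB; rewrite muln2 => EB.
have := odd_double #|B|; rewrite -EB cardsCs finset.setCK oddB ?max_card //.
by rewrite (negbTE eT) oS.
Qed.

(* The summand depends only on the class: rep is any choice of representatives. *)
Theorem theorem7p3 (R : realType) (n k m : nat)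
    (hn : (1 <= n)%N) (hk : (2 <= k)%N) (even_k : ~~ odd k) (hm : m = k./2)
    (rep : {set colored_system m} -> colored_system m)
    (rep_mem : forall C : {set colored_system m},
       C \in barbell_graph_classes m -> rep C \in C) :
  (#|barbell_group m|%:R)^-1 * spin_moment R n k =
  \sum_(C in barbell_graph_classes m)
     n%:R ^+ green_components (rep C) / #|barbell_aut (rep C)|%:R.
Proof.
rewrite sum_barbell_classes // sum_barbell_graphs; congr (_ * _).
(* With [k] as the number of vertices, the subsets in the expansion of Tr x^k are the sets of green
   vertices. *)
have kE : k = #|Xi m| by rewrite card_ord hm even_halfK.
by rewrite {1}kE (spin_moment_pairings _ _ (barbells_pairing m)) // -kE (leq_trans _ hk).
Qed.
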